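(* For $k^2<\delta n$, $\log \mathrm{PS}_\delta(H^n_k)=\Omega(k\log(k/\delta))$; that is, any $\delta$-error randomized parity decision tree deciding the $k$-Hamming weight predicate on $\{0,1\}^n$ has size $\exp\Omega(k\log(k/\delta))$.
   Context: $H^n_k\colon\mathbb{F}_2^n\to\{0,1\}$ equals 1 iff its input has Hamming weight exactly $k$. A (deterministic) parity decision tree is a binary tree each of whose internal nodes is labeled by some $y\in\mathbb{F}_2^n$ and each leaf by an output in $\{0,1\}$; on input $x$ one walks from the root, at a node labeled $y$ going to the left child if $\langle x,y\rangle=0$ (inner product over $\mathbb{F}_2$) and to the right child otherwise, and outputs the label of the leaf reached. Its size is its total number of nodes. A $\delta$-error randomized parity decision tree for $P$ is a probability distribution over deterministic parity decision trees such that for every $x$ the sampled tree outputs $P(x)$ with probability at least $1-\delta$; its size is the maximum size of a tree in its support. $\mathrm{PS}_\delta(P)$ is the minimum size of a $\delta$-error randomized parity decision tree for $P$. Logarithms and $\exp$ are base 2.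
   Formalization: The error δ is restricted to 0 < δ ≤ 1/3; without an upper bound the claim fails, since for δ ≥ 1/2 mixing the two constant trees evenly gives size 1, and no absolute constant works as δ approaches 1/2. *)

(* Defs.v *)
From mathcomp Require Import all_boot.
From Stdlib Require Import Reals.

Set Implicit Arguments.
Unset Strict Implicit.
Unset Printing Implicit Defensive.

Definition vecF2 (n : nat) := {ffun 'I_n -> bool}.

Definition ipF2 (n : nat) (x y : vecF2 n) : bool :=
  \big[xorb/false]_(i < n) (x i && y i).

Definition hweight (n : nat) (x : vecF2 n) : nat := #|[pred i | x i]|.
Definition Hk (n k : nat) (x : vecF2 n) : bool := hweight x == k.

Inductive pdt (n : nat) : Type :=
| Leaf of bool
| Node of vecF2 n & pdt n & pdt n.

Fixpoint pdt_eval (n : nat) (t : pdt n) (x : vecF2 n) : bool :=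
  match t with
  | Leaf b => b
  | Node y l r => if ipF2 x y then pdt_eval r x else pdt_eval l x
  end.

Fixpoint pdt_size (n : nat) (t : pdt n) : nat :=
  match t with
  | Leaf _ => 1
  | Node _ l r => (pdt_size l + pdt_size r).+1
  end.

(* A randomized PDT: a finitely supported probability distribution over
   deterministic PDTs, given as a list of (probability, tree) pairs. *)
Definition rpdt (n : nat) := seq (R * pdt n).

Definition rsum (n : nat) (f : R * pdt n -> R) (D : rpdt n) : R :=
  foldr (fun p acc => (f p + acc)%R) 0%R D.

Definition is_distribution (n : nat) (D : rpdt n) : Prop :=
  (forall p, List.In p D -> (0 < fst p)%R) /\ rsum (fun p => fst p) D = 1%R.

Definition prob_correct (n : nat) (P : vecF2 n -> bool) (D : rpdt n)
  (x : vecF2 n) : R :=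
  rsum (fun p => if pdt_eval (snd p) x == P x then fst p else 0%R) D.

Definition is_rpdt_for (n : nat) (P : vecF2 n -> bool) (delta : R)
  (D : rpdt n) : Prop :=
  is_distribution D /\ forall x : vecF2 n, (1 - delta <= prob_correct P D x)%R.

Definition rpdt_size (n : nat) (D : rpdt n) : nat :=
  foldr maxn 0 [seq pdt_size (snd p) | p <- D].

Definition log2 (x : R) : R := (ln x / ln 2)%R.

(* Main.v *)
Require Import Defs.
From mathcomp Require Import all_boot all_order all_algebra.
From mathcomp Require Import reals sequences exp zify ring lra.
From mathcomp Require Import Rstruct Rstruct_topology.

(** Start a walk at 0 and flip [t] uniformly random coordinates; since
    [k ^ 2 < delta * n], its endpoint has weight [t] with high probability for
    [t <= k + 2].  A leaf of a parity decision tree is an affine subspace, and the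
    probability [m t] that the walk ends in it is the probability that a symmetric
    random walk on syndromes goes from [o] to [b] in [t] steps.

    Such hitting probabilities are nearly log-convex.  Resampling a detour at step
    [a] of a [t]-step walk gives a [(t + 2)]-step walk, with density
    [rho a / m t].  Two detours at different steps have the exact correlation
    [m (t - 2) / (m t) ^ 2], and the product of the [rho a] along every walk is
    [(m t) ^ -2], so that most of them are at most [K] as soon as [ln K] is a large
    multiple of [ln (1 / m t) / t].  Cauchy-Schwarz for the sum of the truncated
    [rho a] then gives, up to a constant close to 1,
      [(m t) ^ 2 <= m (t + 2) * (m (t - 2) + K / t * m t)].

    With [K = k / (50 delta)] and [t = k], every leaf either has
    [m k <= (k / delta) ^ (- Omega(k))] or satisfies this inequality, which by AM-GM
    is linear in the [m]'s.  Summing over the leaves, and averaging over the trees,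
    the acceptance probabilities (about 1 at weight [k], at most [delta] at weights
    [k - 2] and [k + 2]) violate the linear inequality by a constant, so the number of
    leaves is at least [(k / delta) ^ Omega(k)]. *)

Set Implicit Arguments.
Unset Strict Implicit.
Unset Printing Implicit Defensive.
Import Order.TTheory GRing.Theory Num.Theory.
Local Open Scope ring_scope.

(** * Near log-convexity of measured heat *)

Section MeasuredHeat.
Context (F : realType) (T : finType) (S : T -> T -> F) (o b : T).
Hypothesis S_ge0 : forall x y, 0 <= S x y.
Hypothesis S_sym : forall x y, S x y = S y x.
Hypothesis S_sub : forall x, \sum_y S x y <= 1.

Fixpoint fwd a x : F :=
  if a is a'.+1 then \sum_y fwd a' y * S y x else (x == o)%:R.

Fixpoint bwd j x : F :=
  if j is j'.+1 then \sum_y S x y * bwd j' y else (x == b)%:R.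

Definition heat t := fwd t b.

Lemma fwd_ge0 a x : 0 <= fwd a x.
Proof.
elim: a x => [|a IH] x /=; first exact: ler0n.
by apply: sumr_ge0 => y _; apply: mulr_ge0.
Qed.

Lemma bwd_ge0 j x : 0 <= bwd j x.
Proof.
elim: j x => [|j IH] x /=; first exact: ler0n.
by apply: sumr_ge0 => y _; apply: mulr_ge0.
Qed.

Lemma fwdS_ge a x y : fwd a x * S x y <= fwd a.+1 y.
Proof.
rewrite /= (bigD1 x) //= lerDl.
by apply: sumr_ge0 => z _; rewrite mulr_ge0 ?fwd_ge0.
Qed.

Lemma bwdS_ge j x y : S x y * bwd j y <= bwd j.+1 x.
Proof.
rewrite /= (bigD1 y) //= lerDl.
by apply: sumr_ge0 => z _; rewrite mulr_ge0 ?bwd_ge0.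
Qed.

Lemma sum_fwd_bwd a j : \sum_x fwd a x * bwd j x = heat (a + j).
Proof.
elim: j a => [|j IH] a.
  rewrite addn0 (bigD1 b) //= eqxx mulr1 big1 ?addr0 // => x /negPf->.
  by rewrite mulr0.
rewrite -addSnnS -IH /=.
under eq_bigr do rewrite mulr_sumr.
under [RHS]eq_bigr do rewrite mulr_suml.
rewrite exchange_big /=.
by apply: eq_bigr => y _; apply: eq_bigr => x _; rewrite mulrA.
Qed.

Lemma heat_ge0 t : 0 <= heat t.
Proof. exact: fwd_ge0. Qed.

Lemma bwd_heat t : bwd t o = heat t.
Proof.
rewrite -[t in RHS]add0n -sum_fwd_bwd (bigD1 o) //= eqxx mul1r.
by rewrite big1 ?addr0 // => x /negPf->; rewrite mul0r.
Qed.

(** * Moments of an additive functional of walks *)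

Section Moments.
Variable h : nat -> T -> T -> F.

(* With [N] the sum of [h k] over the steps [k < i] of a walk of length [i],
   these are the integrals of [N] and [N ^+ 2] over the walks ending at [y]. *)
Fixpoint mom1 i y : F :=
  if i is i'.+1 then \sum_x S x y * (mom1 i' x + h i' x y * fwd i' x) else 0.

Fixpoint mom2 i y : F :=
  if i is i'.+1 then
    \sum_x S x y * (mom2 i' x + 2 * h i' x y * mom1 i' x
                    + h i' x y ^+ 2 * fwd i' x)
  else 0.

(** This is the integral of [(N - z) ^+ 2] over the walks ending at [x]. Splitting off the last step
    replaces [z] by [z - h], since [N + h - z = N - (z - h)]. *)
Lemma moments_psd i z x :
  0 <= mom2 i x - 2 * z * mom1 i x + z ^+ 2 * fwd i x.
Proof.
elim: i z x => [|i IH] z x /=.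
  by rewrite mulr0 subr0 add0r mulr_ge0 ?sqr_ge0 ?ler0n.
rewrite [2 * z * _]mulr_sumr [z ^+ 2 * _]mulr_sumr -sumrB -big_split /=.
apply: sumr_ge0 => y _.
have := mulr_ge0 (S_ge0 y x) (IH (z - h i y x) y).
by congr (_ <= _); ring.
Qed.

Lemma sum_mom1_bwd i j : \sum_x mom1 i x * bwd j x =
  \sum_(k < i) \sum_x \sum_y S x y * (h k x y * fwd k x) * bwd (i + j - k.+1) y.
Proof.
elim: i j => [|i IH] j; first by rewrite big_ord0 big1 // => x _; rewrite mul0r.
rewrite big_ord_recr /= addSnnS -IH addnS subSS addKn -big_split /=.
under eq_bigr do rewrite mulr_suml.
rewrite exchange_big /=; apply: eq_bigr => x _.
rewrite mulr_sumr -big_split /=; apply: eq_bigr => y _; ring.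
Qed.

Lemma sum_mom2_bwd i j : \sum_x mom2 i x * bwd j x =
  \sum_(k < i) \sum_x \sum_y S x y *
     (2 * h k x y * mom1 k x + h k x y ^+ 2 * fwd k x) * bwd (i + j - k.+1) y.
Proof.
elim: i j => [|i IH] j; first by rewrite big_ord0 big1 // => x _; rewrite mul0r.
rewrite big_ord_recr /= addSnnS -IH addnS subSS addKn -big_split /=.
under eq_bigr do rewrite mulr_suml.
rewrite exchange_big /=; apply: eq_bigr => x _.
rewrite mulr_sumr -big_split /=; apply: eq_bigr => y _; ring.
Qed.

(** Cauchy-Schwarz in linearized form: [(N - z) ^+ 2] has a nonnegative integral, and [z] stays free
    to be chosen later. *)
Lemma second_moment i z :
  2 * z * (\sum_x mom1 i x * bwd 0 x) <=
  \sum_x mom2 i x * bwd 0 x + z ^+ 2 * heat i.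
Proof.
rewrite -[heat i](congr1 heat (addn0 i)) -sum_fwd_bwd -subr_ge0.
rewrite [2 * z * _]mulr_sumr [z ^+ 2 * _]mulr_sumr -big_split -sumrB /=.
apply: sumr_ge0 => x _.
have := mulr_ge0 (moments_psd i z x) (bwd_ge0 0 x).
by congr (_ <= _); rewrite /=; ring.
Qed.

End Moments.

(** * Resampled detours and their truncation *)

Section Detour.
Variables (t : nat) (K : F).
Hypothesis K_gt1 : 1 < K.

(* A walk of length [t] becomes one of length [t + 2] by moving back and forth
   along its step [a], from [x] to [y]; [rho a x y] is, up to the factor
   [heat t], the density of the resulting measure when both the new endpoints
   are resampled from the walk conditioned to end at [b]. *)
Definition rho a x y : F :=
  bwd (t - a.+1) y * fwd a x / (fwd a.+1 y * bwd (t - a) x).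

Definition trho a x y : F := if rho a x y <= K then rho a x y else 0.

(** In the walk of length [t + 2] the backward move along the edge is step [a + 1]. Hence the
    shifted index and the swapped arguments; the first and last steps carry no detour. *)
Definition detour k x y : F :=
  if k is a.+1 then if (a < t)%N then trho a y x else 0 else 0.

Definition edge a x y : F := fwd a x * S x y * bwd (t - a.+1) y.

Definition bad a : F := \sum_x \sum_y edge a x y * (~~ (rho a x y <= K))%:R.

Lemma rho_ge0 a x y : 0 <= rho a x y.
Proof. by rewrite /rho divr_ge0 ?mulr_ge0 ?fwd_ge0 ?bwd_ge0. Qed.

Lemma trho_ge0 a x y : 0 <= trho a x y.
Proof. by rewrite /trho; case: ifP => // _; exact: rho_ge0. Qed.

Lemma trho_le a x y : trho a x y <= rho a x y.
Proof. by rewrite /trho; case: ifP => // _; exact: rho_ge0. Qed.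

Lemma trho_leK a x y : trho a x y <= K.
Proof. by rewrite /trho; case: ifP => // _; move: K_gt1; lra. Qed.

Lemma edge_ge0 a x y : 0 <= edge a x y.
Proof. by rewrite /edge !mulr_ge0 ?fwd_ge0 ?bwd_ge0. Qed.

Lemma edge_gt0 a x y : (a < t)%N -> 0 < edge a x y ->
  [/\ 0 < fwd a x, 0 < S x y, 0 < bwd (t - a.+1) y,
      0 < fwd a.+1 y & 0 < bwd (t - a) x].
Proof.
move=> a_lt; rewrite /edge => e_gt0.
have f0 := fwd_ge0 a x; have b0 := bwd_ge0 (t - a.+1) y; have s0 := S_ge0 x y.
have fp : 0 < fwd a x.
  by rewrite lt_def f0 andbT; apply: contraTneq e_gt0 => ->; rewrite !mul0r ltxx.
have sp : 0 < S x y.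
  by rewrite lt_def s0 andbT; apply: contraTneq e_gt0 => ->; rewrite mulr0 mul0r ltxx.
have bp : 0 < bwd (t - a.+1) y.
  by rewrite lt_def b0 andbT; apply: contraTneq e_gt0 => ->; rewrite mulr0 ltxx.
split=> //; first by apply: lt_le_trans (fwdS_ge a x y); rewrite mulr_gt0.
rewrite (_ : (t - a)%N = (t - a.+1).+1); last by rewrite subnSK.
by apply: lt_le_trans (bwdS_ge _ x y); rewrite mulr_gt0.
Qed.

Lemma sum_edge_r a x : (a < t)%N ->
  \sum_y edge a x y = fwd a x * bwd (t - a) x.
Proof.
move=> a_lt; rewrite -(subnSK a_lt) /= mulr_sumr.
by apply: eq_bigr => y _; rewrite /edge mulrA.
Qed.

Lemma sum_edge_l a y : \sum_x edge a x y = fwd a.+1 y * bwd (t - a.+1) y.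
Proof. by rewrite /= mulr_suml. Qed.

Lemma sum_edge a : (a < t)%N -> \sum_x \sum_y edge a x y = heat t.
Proof.
move=> a_lt; rewrite (eq_bigr _ (fun x _ => sum_edge_r x a_lt)).
by rewrite sum_fwd_bwd subnKC // ltnW.
Qed.

(** Undoing the detour: the factors [fwd a.+1 x] cancel, and the rest sums over [x], by the
    recursion of [bwd], to [fwd a y]. So a prefix of [a + 2] steps ending in a detour counts as one
    of [a] steps. *)
Lemma sum_trho_fwd a y : (a < t)%N ->
  \sum_x S x y * (trho a y x * fwd a.+1 x) <= fwd a y.
Proof.
move=> a_lt.
have ->: fwd a y = fwd a y * 1 by rewrite mulr1.
(* The quotient is 1, or 0 if [bwd (t - a) y] vanishes; either way it is at most 1. *)
apply: (@le_trans _ _ (fwd a y * (bwd (t - a) y / bwd (t - a) y))); last first.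
  rewrite ler_wpM2l ?fwd_ge0 //.
  by have [->|nz] := eqVneq (bwd (t - a) y) 0; rewrite ?mul0r ?divff.
rewrite mulrA -sum_edge_r // mulr_suml; apply: ler_sum => x _.
apply: (@le_trans _ _ (S x y * (rho a y x * fwd a.+1 x))).
  by rewrite ler_wpM2l // ler_wpM2r ?fwd_ge0 // trho_le.
rewrite /rho /edge (S_sym x y).
have [->|nz] := eqVneq (fwd a.+1 x) 0.
  by rewrite !mulr0 divr_ge0 ?mulr_ge0 ?fwd_ge0 ?bwd_ge0.
rewrite invfM.
rewrite [leLHS](_ : _ = (fwd a.+1 x)^-1 * fwd a.+1 x *
  (fwd a y * S y x * bwd (t - a.+1) x / bwd (t - a) y)); last by ring.
by rewrite mulVf // mul1r.
Qed.

Lemma sum_trho_bwd a x : (a < t)%N ->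
  \sum_y S x y * trho a y x * bwd (t - a) y <= bwd (t - a.+1) x.
Proof.
move=> a_lt.
have ->: bwd (t - a.+1) x = 1 * bwd (t - a.+1) x by rewrite mul1r.
apply: (@le_trans _ _ ((fwd a.+1 x)^-1 * fwd a.+1 x * bwd (t - a.+1) x)); last first.
  rewrite ler_wpM2r ?bwd_ge0 //.
  by have [->|nz] := eqVneq (fwd a.+1 x) 0; rewrite ?mulr0 ?mulVf.
rewrite -mulrA -sum_edge_l // mulr_sumr; apply: ler_sum => y _.
apply: (@le_trans _ _ (S x y * rho a y x * bwd (t - a) y)).
  by rewrite ler_wpM2r ?bwd_ge0 // ler_wpM2l // trho_le.
rewrite /rho /edge (S_sym x y).
have [->|nz] := eqVneq (bwd (t - a) y) 0.
  by rewrite !mulr0 mulr_ge0 ?invr_ge0 ?mulr_ge0 ?fwd_ge0 ?bwd_ge0.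
rewrite invfM.
rewrite [leLHS](_ : _ = (bwd (t - a) y)^-1 * bwd (t - a) y *
  ((fwd a.+1 x)^-1 * (fwd a y * S y x * bwd (t - a.+1) x))); last by ring.
by rewrite mulVf // mul1r.
Qed.

Lemma detour_ge0 k x y : 0 <= detour k x y.
Proof. by case: k => [|a] //=; case: ifP => // _; exact: trho_ge0. Qed.

Lemma mom1_detour_ge0 i y : 0 <= mom1 detour i y.
Proof.
elim: i y => [|i IH] y //=; apply: sumr_ge0 => x _.
by rewrite mulr_ge0 // addr_ge0 // mulr_ge0 ?detour_ge0 ?fwd_ge0.
Qed.

(** Among [i + 1] steps there are at most [i] detours, and removing any of them leaves [i - 1]
    steps. *)
Lemma mom1_detour_le i y : mom1 detour i.+1 y <= i%:R * fwd i.-1 y.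
Proof.
elim: i y => [|i IH] y.
  by rewrite mul0r /= big1 // => x _; rewrite mul0r addr0 mulr0.
rewrite [mom1 _ _ _]/= -/(mom1 detour i.+1).
under eq_bigr do rewrite mulrDr.
rewrite big_split /= -natr1 mulrDl mul1r lerD //; last first.
  have [it|ti] := ltnP i t; first exact: sum_trho_fwd.
  by rewrite big1 ?fwd_ge0 // => x _; rewrite mul0r mulr0.
case: i IH => [|i] IH.
  rewrite mul0r; under eq_bigr => x _.
    rewrite (_ : \sum__ _ = mom1 detour 1 x) //; over.
  by apply: sumr_le0 => x _; rewrite mulr_ge0_le0 //; have := IH x; rewrite mul0r.
rewrite [fwd _ _]/= mulr_sumr; apply: ler_sum => x _.
by rewrite [leRHS]mulrA [leRHS]mulrC ler_wpM2l //; exact: IH.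
Qed.

(** Since [rho] is a density, an untruncated detour would integrate to [heat t]; truncation at step
    [a] loses at most [bad a]. *)
Lemma detour_mom1_lb :
  t%:R * heat t - \sum_(a < t) bad a <= \sum_x mom1 detour t.+2 x * bwd 0 x.
Proof.
have H a : (a < t)%N -> heat t - bad a <=
    \sum_x \sum_y S x y * (trho a y x * fwd a.+1 x) * bwd (t - a) y.
  move=> a_lt; rewrite -(sum_edge a_lt) /bad -sumrB [leRHS]exchange_big /=.
  under eq_bigr do rewrite -sumrB.
  apply: ler_sum => x _; apply: ler_sum => y _; rewrite -/(fwd a.+1 y).
  have := edge_ge0 a x y; rewrite le_eqVlt => /orP[/eqP<-|].
    by rewrite mul0r subr0 !mulr_ge0 ?bwd_ge0 ?fwd_ge0 ?trho_ge0.
  move=> /(edge_gt0 a_lt)[p1 p2 p3 p4 p5].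
  rewrite /trho; case: ifP => _ /=; last by rewrite mulr1 mul0r mulr0 mul0r subrr.
  rewrite mulr0 subr0 /rho /edge (S_sym y x) le_eqVlt; apply/orP; left; apply/eqP.
  by rewrite -/(fwd a.+1 y); move: (fwd a.+1 y) p4 => f p4; field; rewrite !gt_eqF.
rewrite sum_mom1_bwd addn0 big_ord_recr /= ltnn.
rewrite [X in _ <= _ + X]big1 ?addr0; last first.
  by move=> x _; rewrite big1 // => y _; rewrite mul0r mulr0 mul0r.
rewrite big_ord_recl /= [X in _ <= X + _]big1 ?add0r; last first.
  by move=> x _; rewrite big1 // => y _; rewrite mul0r mulr0 mul0r.
have -> : t%:R * heat t = \sum_(a < t) heat t by rewrite sumr_const card_ord mulr_natl.
rewrite -sumrB; apply: ler_sum => -[a a_lt] _ /=.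
by rewrite /bump /= add1n a_lt !subSS; exact: H.
Qed.

(** A detour at step [a] pairs with at most [a] earlier ones, and removing both leaves walks of
    length [t - 2]. On the diagonal one factor is bounded by [K] and the other integrates to at most
    [heat t]. *)
Lemma detour_mom2_ub :
  \sum_x mom2 detour t.+2 x * bwd 0 x <=
  t%:R ^+ 2 * heat (t - 2) + t%:R * K * heat t.
Proof.
have H a : (a < t)%N -> \sum_x \sum_y S x y *
    (2 * trho a y x * mom1 detour a.+1 x + trho a y x ^+ 2 * fwd a.+1 x) *
    bwd (t - a) y <= 2 * a%:R * heat (t - 2) + K * heat t.
  move=> a_lt.
  under eq_bigr => x _.
    under eq_bigr do rewrite mulrDr mulrDl.
    rewrite big_split /=; over.
  rewrite big_split /= lerD //.
    apply: (@le_trans _ _ (\sum_x 2 * (a%:R * fwd a.-1 x) * bwd (t - a.+1) x)).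
      apply: ler_sum => x _.
      apply: (@le_trans _ _ (2 * mom1 detour a.+1 x * bwd (t - a.+1) x)); last first.
        by rewrite ler_wpM2r ?bwd_ge0 // ler_wpM2l //; exact: mom1_detour_le.
      apply: le_trans (ler_wpM2l _ (sum_trho_bwd x a_lt)); last first.
        by rewrite mulr_ge0 // mom1_detour_ge0.
      rewrite mulr_sumr; apply: ler_sum => y _; rewrite le_eqVlt; apply/orP; left.
      by apply/eqP; rewrite -/(mom1 detour a.+1 x); ring.
    under eq_bigr do rewrite mulrA -[_ * _ * bwd _ _]mulrA.
    rewrite -mulr_sumr; case: a a_lt => [|a] a_lt; first by rewrite !(mulr0,mul0r).
    by rewrite sum_fwd_bwd /= (_ : (a + (t - a.+2))%N = (t - 2)%N) //; lia.
  apply: (@le_trans _ _ (K * \sum_y (fwd a y * bwd (t - a) y))); last first.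
    by rewrite sum_fwd_bwd subnKC // ltnW.
  rewrite exchange_big mulr_sumr; apply: ler_sum => y _ /=.
  rewrite mulrA -mulr_suml ler_wpM2r ?bwd_ge0 //.
  apply: le_trans (ler_wpM2l _ (sum_trho_fwd y a_lt)); last by move: K_gt1; lra.
  rewrite mulr_sumr; apply: ler_sum => x _.
  rewrite expr2 -mulrA mulrCA ler_wpM2r ?trho_leK //.
  by rewrite -/(fwd a.+1 x) !mulr_ge0 ?trho_ge0 ?fwd_ge0.
rewrite sum_mom2_bwd addn0 big_ord_recr /= ltnn.
rewrite [X in _ + X <= _]big1 ?addr0; last first.
  move=> x _; rewrite big1 // => y _.
  by rewrite expr2 !(mulr0, mul0r, addr0).
rewrite big_ord_recl /= [X in X + _ <= _]big1 ?add0r; last first.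
  by move=> x _; rewrite big1 // => y _; rewrite expr2 !(mulr0, mul0r, addr0).
apply: (@le_trans _ _ (\sum_(a < t) (2 * a%:R * heat (t - 2) + K * heat t))).
  apply: ler_sum => -[a a_lt] _ /=.
  by rewrite /bump /= add1n a_lt !subSS; exact: H.
rewrite big_split /= sumr_const card_ord -[_ *+ t]mulr_natl mulrA lerD2r.
rewrite -mulr_suml ler_wpM2r ?heat_ge0 //.
elim: (t) => [|s IH]; first by rewrite big_ord0 expr2 mulr0.
rewrite big_ord_recr /= -[s.+1%:R]natr1; apply: le_trans (lerD IH (lexx _)) _.
lra.
Qed.

Definition logratio a x : F := ln (bwd (t - a) x) - ln (fwd a x).

(** On a bad edge [ln K] is below [ln (rho a x y)], the increment of [logratio]. Elsewhere that
    increment may be negative; [- ln r <= r^-1], applied to two factors of [rho], bounds the loss by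
    the extra terms. *)
Lemma bad_pointwise a x y : (a < t)%N ->
  edge a x y * (~~ (rho a x y <= K))%:R * ln K <=
  edge a x y * (logratio a.+1 y - logratio a x)
  + (fwd a x * S x y * bwd (t - a) x + fwd a.+1 y * S x y * bwd (t - a.+1) y).
Proof.
move=> a_lt.
have e0 := edge_ge0 a x y.
have q1 : 0 <= fwd a x * S x y * bwd (t - a) x by rewrite !mulr_ge0 ?fwd_ge0 ?bwd_ge0.
have q2 : 0 <= fwd a.+1 y * S x y * bwd (t - a.+1) y.
  by rewrite !mulr_ge0 ?fwd_ge0 ?bwd_ge0.
move: (e0); rewrite le_eqVlt => /orP[/eqP<-|ep]; first by rewrite !mul0r add0r addr_ge0.
have [p1 p2 p3 p4 p5] := edge_gt0 a_lt ep.
have lnr : ln (rho a x y) = logratio a.+1 y - logratio a x.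
  rewrite /rho /logratio ln_div ?posrE ?mulr_gt0 // !lnM ?posrE //.
  by ring.
case: (leP (rho a x y) K) => [_|Kr] /=; last first.
  rewrite mulr1 -[leLHS]addr0 lerD ?addr_ge0 //; rewrite ler_wpM2l // -lnr.
  by rewrite ler_ln ?posrE ?ltW //; move: K_gt1 Kr; lra.
rewrite mulr0 mul0r.
have ln_lb (r : F) : 0 < r -> - ln r <= r^-1.
  move=> r0; rewrite -lnV ?posrE //.
  by apply/ltW/ln_sublinear; rewrite invr_gt0.
have H1 := ln_lb _ (divr_gt0 p3 p5); have H2 := ln_lb _ (divr_gt0 p1 p4).
rewrite !invf_div !ln_div ?posrE // in H1 H2.
have E1 : fwd a x * S x y * bwd (t - a) x =
          edge a x y * (bwd (t - a) x / bwd (t - a.+1) y).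
  by rewrite /edge; field; rewrite gt_eqF.
have E2 : fwd a.+1 y * S x y * bwd (t - a.+1) y =
          edge a x y * (fwd a.+1 y / fwd a x).
  by rewrite /edge; move: (fwd a.+1 y) => f; field; rewrite gt_eqF.
rewrite E1 E2 -!mulrDr mulr_ge0 // /logratio.
move: H1 H2; move: (_ / _) (_ / _) => u v.
by move: (ln (fwd a.+1 y)) => w; lra.
Qed.

Lemma sum_edge_logratio a : (a < t)%N ->
  \sum_x \sum_y edge a x y * (logratio a.+1 y - logratio a x) =
  \sum_x fwd a.+1 x * bwd (t - a.+1) x * logratio a.+1 x -
  \sum_x fwd a x * bwd (t - a) x * logratio a x.
Proof.
move=> a_lt.
under eq_bigr => x _.
  under eq_bigr do rewrite mulrBr.
  rewrite sumrB -mulr_suml (sum_edge_r _ a_lt); over.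
rewrite sumrB; congr (_ - _); rewrite exchange_big /=.
by apply: eq_bigr => y _; rewrite -mulr_suml sum_edge_l.
Qed.

(* The logarithms of [rho] telescope along every walk, to [- 2 * ln (heat t)]. *)
Lemma sum_bad : ln K * \sum_(a < t) bad a <= heat t * (2 * t%:R - 2 * ln (heat t)).
Proof.
pose L a := \sum_x fwd a x * bwd (t - a) x * logratio a x.
have step a : (a < t)%N -> bad a * ln K <= (L a.+1 - L a) + 2 * heat t.
  move=> a_lt; rewrite /L -sum_edge_logratio // /bad mulr_suml.
  apply: (@le_trans _ _ (\sum_x \sum_y
    (edge a x y * (logratio a.+1 y - logratio a x)
    + (fwd a x * S x y * bwd (t - a) x + fwd a.+1 y * S x y * bwd (t - a.+1) y)))).
    apply: ler_sum => x _; rewrite mulr_suml; apply: ler_sum => y _.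
    exact: bad_pointwise.
  under eq_bigr do rewrite !big_split.
  (* In each extra term [S x y] sums to at most 1 by [S_sub], the second time after symmetry; what
     remains is [heat t]. *)
  rewrite !big_split /= lerD2l mulr_natl mulr2n lerD //.
    rewrite -[t in heat t](subnKC (ltnW a_lt)) -sum_fwd_bwd.
    apply: ler_sum => x _; rewrite -mulr_suml -mulr_sumr ler_wpM2r ?bwd_ge0 //.
    by rewrite -[leRHS]mulr1 ler_wpM2l ?fwd_ge0.
  rewrite -[t in heat t](subnKC a_lt) -sum_fwd_bwd exchange_big /=.
  apply: ler_sum => y _; rewrite -mulr_suml -mulr_sumr ler_wpM2r ?bwd_ge0 //.
  rewrite -[leRHS]mulr1 ler_wpM2l ?(fwd_ge0 a.+1) //.
  by under eq_bigr do rewrite S_sym.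
have tele : \sum_(a < t) (L a.+1 - L a) = L t - L 0%N.
  by rewrite -(big_mkord xpredT (fun a => L a.+1 - L a)) telescope_sumr.
have Lt : L t = - (heat t * ln (heat t)).
  rewrite /L subnn (bigD1 b) //= eqxx big1 ?addr0; last first.
    by move=> x /negPf nx; rewrite nx mulr0 mul0r.
  by rewrite /logratio subnn /= eqxx ln1 sub0r mulr1 mulrN.
have L0 : L 0%N = heat t * ln (heat t).
  rewrite /L subn0 (bigD1 o) //= eqxx big1 ?addr0; last first.
    by move=> x /negPf nx; rewrite nx !mul0r.
  by rewrite /logratio subn0 /= eqxx ln1 subr0 mul1r bwd_heat.
rewrite mulrC mulr_suml.
apply: (@le_trans _ _ (\sum_(a < t) ((L a.+1 - L a) + 2 * heat t))).
  by apply: ler_sum => a _; exact: step.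
rewrite big_split /= tele Lt L0 sumr_const card_ord -[_ *+ t]mulr_natl.
by rewrite le_eqVlt; apply/orP; left; apply/eqP; ring.
Qed.

End Detour.

(** This is [second_moment] at [z = t * y], divided by [t ^ 2 * y]. The hypothesis on [K] keeps the
    total bad mass below [t * heat t / 20], which turns the factor 2 into 19 / 10. *)
Lemma heat_near_log_convex t (K y : F) : (0 < t)%N -> 1 < K -> 0 < y ->
  40 * (t%:R - ln (heat t)) <= t%:R * ln K ->
  19 / 10 * heat t <= y * heat t.+2 + y^-1 * (heat (t - 2) + K / t%:R * heat t).
Proof.
move=> t0 K1 y0 hK.
have tp : 0 < t%:R :> F by rewrite ltr0n.
have m1 := detour_mom1_lb t K; have m2 := detour_mom2_ub t K1.
have sb := sum_bad t K1; have lK := ln_gt0 K1; have m0 := heat_ge0 t.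
have sm := second_moment (detour t K) t.+2 (t%:R * y).
set Q := \sum_(a < t) bad t K a in m1 sb.
have Qle : Q <= t%:R * heat t / 20.
  rewrite -(ler_pM2l lK); apply: le_trans sb _.
  have := ler_wpM2l m0 hK; lra.
have ty : 0 < t%:R ^+ 2 * y by rewrite mulr_gt0 ?exprn_gt0.
have E1 : t%:R * heat t * (19 / 20) <= \sum_x mom1 (detour t K) t.+2 x * bwd 0 x.
  by apply: le_trans m1; lra.
have E2 := ler_wpM2l (ltW (mulr_gt0 (ltr0n _ 2) (mulr_gt0 tp y0))) E1.
rewrite -(ler_pM2l ty).
have := le_trans E2 (le_trans sm (lerD m2 (lexx _))).
rewrite (_ : 2 * _ * _ = t%:R ^+ 2 * y * (19 / 10 * heat t)); last by field.
move/le_trans; apply; rewrite le_eqVlt; apply/orP; left; apply/eqP.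
by field; rewrite !gt_eqF.
Qed.

End MeasuredHeat.

(** * Walks on the cube and parity decision trees *)

Section CoordinateWalk.
Context (F : realType) (n : nat).
Implicit Types (f g : vecF2 n -> F) (x y : vecF2 n).

Definition flip x i : vecF2 n := [ffun j => x j (+) (j == i)].

Definition vec0 : vecF2 n := [ffun=> false].

(* Expectation of [f] at the end of a walk of [t] uniform coordinate flips. *)
Fixpoint walkE t f x : F :=
  if t is t'.+1 then n%:R^-1 * \sum_i walkE t' f (flip x i) else f x.

Lemma eq_walkE t f g x : f =1 g -> walkE t f x = walkE t g x.
Proof.
move=> fg; elim: t x => [|t IH] x /=; first exact: fg.
by under eq_bigr do rewrite IH.
Qed.

Lemma walkED t f g x : walkE t (fun z => f z + g z) x = walkE t f x + walkE t g x.
Proof.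
elim: t x => [|t IH] x //=; rewrite -mulrDr -big_split /=.
by under eq_bigr do rewrite IH.
Qed.

Lemma walkEZ t c f x : walkE t (fun z => c * f z) x = c * walkE t f x.
Proof.
elim: t x => [|t IH] x //=; rewrite mulrCA [c * _]mulr_sumr.
by under eq_bigr do rewrite IH.
Qed.

Lemma le_walkE t f g x : (forall z, f z <= g z) -> walkE t f x <= walkE t g x.
Proof.
move=> fg; elim: t x => [|t IH] x /=; first exact: fg.
by rewrite ler_wpM2l ?invr_ge0 ?ler0n // ler_sum.
Qed.

Lemma walkE_cst t c x : (0 < n)%N -> walkE t (fun=> c) x = c.
Proof.
move=> n0; elim: t x => [|t IH] x //=.
under eq_bigr do rewrite IH.
by rewrite sumr_const card_ord -[c *+ n]mulr_natl mulKf // pnatr_eq0 -lt0n.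
Qed.

Lemma hweight_sum x : hweight x = (\sum_i x i)%N.
Proof.
rewrite /hweight -sum1_card big_mkcond /=; apply: eq_bigr => i _.
by rewrite inE; case: (x i).
Qed.

Lemma hweight_vec0 : hweight vec0 = 0%N.
Proof. by rewrite hweight_sum big1 // => i _; rewrite ffunE. Qed.

Lemma hweight_flip x i : (hweight (flip x i) + x i = hweight x + ~~ x i)%N.
Proof.
rewrite !hweight_sum (bigD1 i) //= [in RHS](bigD1 i) //= ffunE eqxx.
under eq_bigr => j ji do rewrite ffunE (negPf ji) addbF.
by case: (x i) => /=; lia.
Qed.

(** Union bound: while all flips have raised the weight, the flip numbered [i < j] hits a one with
    probability [(hweight x + i) / n]. *)
Lemma walkE_weight j x : (0 < n)%N ->
  1 - (j%:R * (hweight x)%:R + (j%:R ^+ 2 - j%:R) / 2) / n%:R <=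
  walkE j (fun z => (hweight z == (hweight x + j)%N)%:R) x.
Proof.
move=> n0; have np : 0 < n%:R :> F by rewrite ltr0n.
elim: j x => [|j IH] x; first by rewrite /= addn0 eqxx mul0r expr2 mul0r
  subrr mul0r addr0 mul0r subr0.
set br : F := 1 - (j%:R * (hweight x).+1%:R + (j%:R ^+ 2 - j%:R) / 2) / n%:R.
have br1 : br <= 1.
  have jj : j%:R <= j%:R ^+ 2 :> F.
    by rewrite -natrX ler_nat; case: (j) => // m; rewrite expnS expn1 leq_pmulr.
  rewrite gerBl; apply: divr_ge0 (ltW np); apply: addr_ge0; first exact: mulr_ge0.
  by rewrite divr_ge0 ?subr_ge0.
apply: (@le_trans _ _ (n%:R^-1 * \sum_i (br - (x i)%:R))); last first.
  rewrite /= ler_wpM2l ?invr_ge0 ?ler0n //; apply: ler_sum => i _.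
  have := hweight_flip x i; case: (x i) => /= hw.
    rewrite (@le_trans _ _ 0) ?subr_le0 //.
    rewrite -[leLHS](@walkE_cst j 0 (flip x i) n0); apply: le_walkE => z.
    exact: ler0n.
  rewrite subr0; have {}hw : hweight (flip x i) = (hweight x).+1 by lia.
  by rewrite /br -hw addnS -addSn -hw; exact: IH.
rewrite sumrB sumr_const card_ord -[br *+ n]mulr_natl -natr_sum -hweight_sum /br.
rewrite le_eqVlt; apply/orP; left; apply/eqP.
by rewrite -[j.+1%:R]natr1 -[(hweight x).+1%:R]natr1; field; rewrite gt_eqF.
Qed.

Lemma walkE_weight_gt j k x : (hweight x + j < k)%N ->
  walkE j (fun z => (hweight z == k)%:R) x = 0.
Proof.
elim: j x => [|j IH] x hk /=; first by rewrite ltn_eqF //; lia.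
rewrite big1 ?mulr0 // => i _; apply: IH.
by have := hweight_flip x i; case: (x i) => /=; lia.
Qed.

Lemma ipF2_addb x y : ipF2 x y = \big[addb/false]_(i < n) (x i && y i).
Proof. by apply: big_rec2 => // i u _ _ <-; case: (_ && _); case: u. Qed.

Lemma ipF2_flip x y i : ipF2 (flip x i) y = ipF2 x y (+) y i.
Proof.
rewrite !ipF2_addb (bigD1 i) //= [in RHS](bigD1 i) //= ffunE eqxx.
under eq_bigr => j ji do rewrite ffunE (negPf ji) addbF.
by case: (x i); case: (y i); case: (\big[_/_]_(_ < _ | _) _).
Qed.

(** Membership in the affine subspace cut out by the answered queries on a path of the tree. *)
Definition ind (c : seq (vecF2 n * bool)) x : bool :=
  all (fun p => ipF2 x p.1 == p.2) c.

(** * Projection of the walk to syndromes *)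

Section Syndrome.
Variable c : seq (vecF2 n * bool).
Let d := size c.
Let query (j : 'I_d) := (nth (vec0, false) c j).1.

Definition syn x : vecF2 d := [ffun j => ipF2 x (query j)].
Definition shift (g : vecF2 d) i : vecF2 d := [ffun j => g j (+) query j i].
Definition target : vecF2 d := [ffun j : 'I_d => (nth (vec0, false) c j).2].

Definition syn_kernel (g h : vecF2 d) : F := n%:R^-1 * \sum_i (h == shift g i)%:R.

Lemma syn_flip x i : syn (flip x i) = shift (syn x) i.
Proof. by apply/ffunP => j; rewrite !ffunE ipF2_flip. Qed.

Lemma ind_syn x : ind c x = (syn x == target).
Proof.
apply/(all_nthP (vec0, false))/eqP => [H|H j jd].
  by apply/ffunP => j; rewrite !ffunE; apply/eqP/H.
by move/ffunP/(_ (Ordinal jd)): H; rewrite !ffunE => /eqP.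
Qed.

Lemma shiftK i : involutive (shift^~ i).
Proof. by move=> g; apply/ffunP => j; rewrite !ffunE -addbA addbb addbF. Qed.

Lemma syn_kernel_ge0 (g h : vecF2 d) : 0 <= syn_kernel g h.
Proof. by rewrite mulr_ge0 ?invr_ge0 ?ler0n ?sumr_ge0. Qed.

Lemma syn_kernel_sym (g h : vecF2 d) : syn_kernel g h = syn_kernel h g.
Proof.
congr (_ * _); apply: eq_bigr => i _; congr (nat_of_bool _)%:R.
by rewrite -(inj_eq (inv_inj (shiftK i))) shiftK eq_sym.
Qed.

Lemma sum_syn_kernel (g : vecF2 d) (f : vecF2 d -> F) :
  \sum_h syn_kernel g h * f h = n%:R^-1 * \sum_i f (shift g i).
Proof.
under eq_bigr do rewrite -mulrA mulr_suml.
rewrite -mulr_sumr exchange_big /=; congr (_ * _); apply: eq_bigr => i _.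
rewrite (bigD1 (shift g i)) //= eqxx mul1r big1 ?addr0 // => h /negPf->.
by rewrite mul0r.
Qed.

Lemma syn_kernel_sub (g : vecF2 d) : \sum_h syn_kernel g h <= 1.
Proof.
under eq_bigr do rewrite -[syn_kernel _ _]mulr1.
rewrite (sum_syn_kernel g (fun=> 1)) sumr_const card_ord.
by case: (posnP n) => [->|n0]; rewrite ?mulr0 // mulVf // pnatr_eq0 -lt0n.
Qed.

(** A flip of coordinate [i] acts on syndromes as [shift] by [i], so the projected walk is Markov
    with kernel [syn_kernel]. *)
Lemma walkE_ind t x :
  walkE t (fun z => (ind c z)%:R) x = bwd syn_kernel target t (syn x).
Proof.
elim: t x => [|t IH] x /=; first by rewrite ind_syn.
by rewrite sum_syn_kernel; under eq_bigr do rewrite IH syn_flip.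
Qed.

End Syndrome.

(** * The linear functional measuring the failure of log-convexity *)

Section Functional.
Variables (t : nat) (K y : F).
Hypotheses (t_gt0 : (0 < t)%N) (K_gt1 : 1 < K) (y_gt0 : 0 < y).

Definition defect f : F := 19 / 10 * walkE t f vec0 -
  (y * walkE t.+2 f vec0 +
   y^-1 * (walkE (t - 2) f vec0 + K / t%:R * walkE t f vec0)).

(** The value of [heat t] at which the hypothesis on [K] in [heat_near_log_convex] becomes an
    equality. *)
Definition threshold : F := expR (t%:R * (1 - ln K / 40)).

Lemma eq_defect f g : f =1 g -> defect f = defect g.
Proof. by move=> fg; rewrite /defect !(eq_walkE _ _ fg). Qed.

Lemma defectD f g : defect (fun z => f z + g z) = defect f + defect g.
Proof. by rewrite /defect !walkED; ring. Qed.

Lemma defectZ c f : defect (fun z => c * f z) = c * defect f.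
Proof. by rewrite /defect !walkEZ; ring. Qed.

(** Below the threshold the only positive term is already small; above it near log-convexity makes
    the defect nonpositive. *)
Lemma defect_ind c : defect (fun z => (ind c z)%:R) <= 2 * threshold.
Proof.
rewrite /defect !walkE_ind !bwd_heat lerBlDr.
set S := @syn_kernel c; set o := syn c vec0; set b := target c.
have Sg := @syn_kernel_ge0 c; have Ss := @syn_kernel_sym c.
have h0 s := heat_ge0 o b Sg s.
have tau0 : 0 < threshold := expR_gt0 _.
have [le_m|lt_m] := leP (heat S o b t) threshold.
  rewrite -[leLHS]addr0 lerD //; first by lra.
  have K0 : 0 <= K / t%:R by rewrite divr_ge0 //; move: K_gt1; lra.
  have y0 := ltW y_gt0; apply: addr_ge0; first exact: mulr_ge0.
  by rewrite mulr_ge0 ?invr_ge0 ?addr_ge0 ?h0 // mulr_ge0 ?h0.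
have m0 : 0 < heat S o b t := lt_trans tau0 lt_m.
rewrite -[leLHS]add0r lerD //; first by lra.
apply: heat_near_log_convex => //; first exact: syn_kernel_sub.
have : ln threshold <= ln (heat S o b t) by rewrite ler_ln ?posrE // ltW.
by rewrite /threshold expRK; lra.
Qed.

Lemma defect_pdt c (T : pdt n) :
  defect (fun z => (ind c z && pdt_eval T z)%:R) <= (pdt_size T)%:R * (2 * threshold).
Proof.
have tau0 : 0 < threshold := expR_gt0 _.
elim: T c => [v|q l IHl r IHr] c /=.
  rewrite mul1r; case: v; last first.
    rewrite (eq_defect (g := fun=> 0 * 0)); last by move=> z; rewrite andbF mul0r.
    by rewrite (defectZ 0 (fun=> 0)) mul0r mulr_ge0 // ltW.
  rewrite (eq_defect (g := fun z => (ind c z)%:R)) ?defect_ind // => z.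
  by rewrite andbT.
rewrite (eq_defect (g := fun z =>
   (ind ((q, false) :: c) z && pdt_eval l z)%:R +
   (ind ((q, true) :: c) z && pdt_eval r z)%:R)); last first.
  move=> z /=; case: (ipF2 z q) => /=; first by rewrite add0r.
  by rewrite addr0.
rewrite defectD -natr1 natrD mulrDl mulrDl.
have := IHl ((q, false) :: c); have := IHr ((q, true) :: c).
lra.
Qed.

End Functional.
End CoordinateWalk.

(** * Randomized trees for the Hamming weight predicate *)

Section RandomizedTree.
Context (F : realType) (n k : nat) (delta : F).
Hypotheses (k_gt0 : (0 < k)%N) (delta_gt0 : 0 < delta) (delta_le : delta <= 1 / 3).
Hypothesis k_small : k%:R ^+ 2 < delta * n%:R.

Let n_gt0 : (0 < n)%N.
Proof.
rewrite lt0n; apply/eqP => n0; move: k_small.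
by rewrite n0 mulr0 ltNge sqr_ge0.
Qed.

Let n_pos : 0 < n%:R :> F. Proof. by rewrite ltr0n. Qed.

(** * Acceptance probabilities along the walk *)

Section Acceptance.
Variable acc : vecF2 n -> F.
Hypothesis acc_ge0 : forall x, 0 <= acc x.
Hypothesis acc_le1 : forall x, acc x <= 1.
Hypothesis acc_yes : forall x, Hk k x -> 1 - delta <= acc x.
Hypothesis acc_no : forall x, ~~ Hk k x -> acc x <= delta.

Lemma walkE_weight0 j :
  1 - (j%:R ^+ 2 - j%:R) / 2 / n%:R <=
  walkE j (fun z => (hweight z == j)%:R) (vec0 n) :> F.
Proof.
by have := walkE_weight F j (vec0 n) n_gt0; rewrite hweight_vec0 mulr0 !add0r.
Qed.

Lemma acc_ub x : acc x <= delta + (hweight x == k)%:R.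
Proof.
have [xk|/acc_no] := boolP (Hk k x).
  by rewrite (eqP xk) eqxx; apply: le_trans (acc_le1 x) _; rewrite lerDr ltW.
by move=> /le_trans; apply; rewrite lerDl.
Qed.

Lemma walk_acc_eq : 1 - delta - (k%:R ^+ 2 - k%:R) / 2 / n%:R <= walkE k acc (vec0 n).
Proof.
apply: (@le_trans _ _ (walkE k (fun z => (hweight z == k)%:R + - delta) (vec0 n))).
  by rewrite walkED walkE_cst // addrAC lerD2r walkE_weight0.
apply: le_walkE => x; have [xk|xk] := boolP (Hk k x).
  by rewrite (xk : hweight x == k); exact: acc_yes.
rewrite (negPf xk : (hweight x == k) = false) add0r.
by apply: le_trans (acc_ge0 x); rewrite oppr_le0 ltW.
Qed.

Lemma walk_acc_lt : walkE (k - 2) acc (vec0 n) <= delta.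
Proof.
apply: le_trans (le_walkE _ _ acc_ub) _.
rewrite walkED walkE_cst // walkE_weight_gt ?addr0 // hweight_vec0 add0n.
(* This covers [k = 1] too, where [k - 2] is 0. *)
by rewrite ltn_subrL.
Qed.

Lemma walk_acc_gt :
  walkE k.+2 acc (vec0 n) <= delta + (k.+2%:R ^+ 2 - k.+2%:R) / 2 / n%:R.
Proof.
apply: (@le_trans _ _ (walkE k.+2 (fun z => (delta + 1) +
    -1 * (hweight z == k.+2)%:R) (vec0 n))).
  apply: le_walkE => x; apply: le_trans (acc_ub x) _.
  rewrite -addrA lerD2l; case: eqP => [->|_]; last by case: eqP => _; rewrite /=; lra.
  by rewrite -[k in k == _]addn0 -addn2 eqn_add2l /=; lra.
rewrite walkED walkEZ walkE_cst //; have := walkE_weight0 k.+2; lra.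
Qed.

(* One of the two alternatives holds when [k / delta] is large. *)
Lemma defect_acc : 1000 <= k%:R :> F \/ delta <= 1 / 20 ->
  1 / 20 <= defect k (k%:R / (50 * delta)) (1 / (3 * delta)) acc.
Proof.
move=> regime; rewrite /defect.
have kp : 1 <= k%:R :> F by rewrite ler1n.
have dn : k%:R ^+ 2 / n%:R <= delta by rewrite ler_pdivrMr // ltW.
have H1 := walk_acc_eq; have H2 := walk_acc_lt; have H3 := walk_acc_gt.
move: H1 H2 H3.
move: (walkE k acc _) (walkE (k - 2) acc _) (walkE k.+2 acc _) => M Ml Mg.
move=> H1 H2 H3.
have dnz : delta != 0 by rewrite gt_eqF.
have Mlb : 1 - 3 / 2 * delta <= M.
  apply: le_trans H1.
  have : 0 <= k%:R / n%:R :> F by rewrite divr_ge0 // ltW.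
  by move: dn; rewrite !mulrBl; lra.
have E : (k%:R / (50 * delta)) / k%:R = (50 * delta)^-1 :> F.
  by field; rewrite dnz gt_eqF //; lra.
rewrite E.
have -> : 19 / 10 * M - (1 / (3 * delta) * Mg +
    (1 / (3 * delta))^-1 * (Ml + (50 * delta)^-1 * M))
  = 19 / 10 * M - Mg / (3 * delta) - 3 * delta * Ml - 3 / 50 * M.
  by field.
have Ml2 : 3 * delta * Ml <= 3 * delta * delta.
  by rewrite ler_wpM2l // mulr_ge0 // ltW.
pose q : F := (k.+2%:R ^+ 2 - k.+2%:R) / 2 / k%:R ^+ 2.
have k2p : 0 < k%:R ^+ 2 :> F by rewrite exprn_gt0 //; lra.
have Mg2 : Mg / (3 * delta) <= (1 + q) / 3.
  have -> : (1 + q) / 3 = (delta + delta * q) / (3 * delta) by field.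
  rewrite ler_pM2r ?invr_gt0 ?mulr_gt0 //; apply: le_trans H3 _; rewrite lerD2l /q.
  have -> : (k.+2%:R ^+ 2 - k.+2%:R) / 2 / n%:R =
    k%:R ^+ 2 / n%:R * ((k.+2%:R ^+ 2 - k.+2%:R) / 2 / k%:R ^+ 2) :> F.
    by field; rewrite !gt_eqF //; lra.
  rewrite ler_wpM2r // !divr_ge0 ?sqr_ge0 // subr_ge0 -natrX ler_nat.
  by rewrite expnS expn1 leq_pmulr.
have q_le c : k%:R ^+ 2 + 3 * k%:R + 2 <= 2 * c * k%:R ^+ 2 -> q <= c.
  move=> h; rewrite /q ler_pdivrMr // -[k.+2]addn2 natrD; lra.
case: regime => [k1000|d20].
  have qc : q <= 502 / 1000 by apply: q_le; nra.
  have d2 : delta * delta <= delta * (1 / 3) by rewrite ler_wpM2l // ltW.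
  by move: delta_le; lra.
have qc : q <= 3 by apply: q_le; nra.
have d2 : delta * delta <= delta * (1 / 20) by rewrite ler_wpM2l // ltW.
by lra.
Qed.

End Acceptance.

Section Distribution.
Variable D : seq (F * pdt n).
Hypothesis D_gt0 : forall p, List.In p D -> 0 < p.1.
Hypothesis D_sum1 : \sum_(p <- D) p.1 = 1.

Definition accept x : F := \sum_(p <- D) p.1 * (pdt_eval p.2 x)%:R.

Hypothesis D_yes : forall x, Hk k x -> 1 - delta <= accept x.
Hypothesis D_no : forall x, ~~ Hk k x -> accept x <= delta.
Variable s : nat.
Hypothesis D_size : forall p, List.In p D -> (pdt_size p.2 <= s)%N.

Lemma ler_sum_In (f g : F * pdt n -> F) :
  (forall p, List.In p D -> f p <= g p) ->
  \sum_(p <- D) f p <= \sum_(p <- D) g p.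
Proof.
elim: (D) => [|p E IH] fg; first by rewrite !big_nil.
rewrite !big_cons lerD ?fg //=; first by left.
by apply: IH => r rE; apply: fg; right.
Qed.

Lemma accept_ge0 x : 0 <= accept x.
Proof.
apply: le_trans (@ler_sum_In (fun=> 0) _ _); first by rewrite big1.
by move=> p /D_gt0 pp; rewrite mulr_ge0 // ltW.
Qed.

Lemma accept_le1 x : accept x <= 1.
Proof.
rewrite -[leRHS]D_sum1; apply: ler_sum_In => p /D_gt0 pp.
by rewrite -[leRHS]mulr1 ler_wpM2l ?(ltW pp) // lern1 leq_b1.
Qed.

Lemma defect_accept (K y : F) : 1 < K -> 0 < y ->
  defect k K y accept <= s%:R * (2 * threshold k K).
Proof.
move=> K1 y0.
have -> : defect k K y accept =
    \sum_(p <- D) p.1 * defect k K y (fun x => (pdt_eval p.2 x)%:R).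
  rewrite /accept; elim: (D) => [|p E IH].
    rewrite big_nil (@eq_defect F n k K y _ (fun=> 0 * 0)); last first.
      by move=> x; rewrite big_nil mul0r.
    by rewrite (defectZ _ _ _ 0 (fun=> 0)) mul0r.
  rewrite big_cons -IH -defectZ -defectD.
  by apply: eq_defect => x; rewrite big_cons.
rewrite -[leRHS]mul1r -[X in _ <= X * _]D_sum1 mulr_suml; apply: ler_sum_In => p pD.
rewrite ler_wpM2l ?(ltW (D_gt0 pD)) //.
apply: (@le_trans _ _ ((pdt_size p.2)%:R * (2 * threshold k K))).
  exact: (defect_pdt k_gt0 K1 y0 [::] p.2).
by rewrite ler_wpM2r ?ler_nat ?D_size // mulr_ge0 // ltW // expR_gt0.
Qed.

Lemma ln_size_large : (200 * 100) <= ln (k%:R / delta) ->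
  k%:R * ln (k%:R / delta) / 80 <= ln s%:R.
Proof.
move=> X_ge; have kp : 1 <= k%:R :> F by rewrite ler1n.
have kp0 : 0 < k%:R :> F by lra.
have kd_gt0 : 0 < k%:R / delta by rewrite divr_gt0.
have kd_ge : (200 * 100) <= k%:R / delta.
  by apply: le_trans X_ge (ltW (ln_sublinear _)).
pose K := k%:R / (50 * delta).
have KE : K = k%:R / delta / 50 by rewrite /K; field; rewrite gt_eqF.
have K1 : 1 < K by rewrite KE; lra.
have y0 : 0 < 1 / (3 * delta) by rewrite divr_gt0 // mulr_gt0.
have regime : 1000 <= k%:R :> F \/ delta <= 1 / 20.
  have [d20|d20] := leP delta (1 / 20); [by right|left].
  have : (200 * 100) * delta <= k%:R by rewrite -ler_pdivlMr.
  lra.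
have := defect_acc accept_ge0 accept_le1 D_yes D_no regime.
move=> /le_trans/(_ (defect_accept K1 y0)); rewrite -/K => sT.
have T0 : 0 < threshold k K := expR_gt0 _.
have s0 : 0 < s%:R :> F.
  rewrite ltr0n lt0n; apply/eqP => s0; move: sT; rewrite s0 mul0r; lra.
have : (40 * threshold k K)^-1 <= s%:R.
  by rewrite -[leLHS]mul1r ler_pdivrMr ?mulr_gt0 //; move: sT; lra.
rewrite -ler_ln ?posrE ?invr_gt0 ?mulr_gt0 // => /(le_trans _); apply.
rewrite lnV ?posrE ?mulr_gt0 // lnM ?posrE // /threshold expRK KE.
have -> : ln (k%:R / delta / 50) = ln (k%:R / delta) - ln 50 by rewrite ln_div ?posrE.
have l40 : ln 40 < 40 :> F by exact: ln_sublinear.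
have l50 : ln 50 < 50 :> F by exact: ln_sublinear.
move: X_ge l40 l50; move: (ln (_ / _)) (ln 40) (ln 50) => X u v X_ge l40 l50.
(* Half of [k * X / 40] pays for [k * v / 40], [k] and [u], because [X] is at least 20000. *)
have h1 := ler_wpM2l (ltW kp0) X_ge; have h2 := ler_wpM2l (ltW kp0) (ltW l50).
by lra.
Qed.

(** Trees with one node are leaves, so acceptance would be constant, yet [vec0] and a vector of
    weight [k] need different values. *)
Lemma size_ge2 : (2 <= s)%N.
Proof.
rewrite leqNgt; apply/negP => s1.
have cst x : accept x = accept (vec0 n).
  rewrite /accept; elim: (D) D_size => [|p E IH] sz; first by rewrite !big_nil.
  rewrite !big_cons IH; last by move=> r rE; apply: sz; right.
  have := sz p (or_introl erefl).
  case: p.2 => [v|q l r] //= /leq_trans/(_ s1).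
  by case: l => [?|? ? ?]; case: r => [?|? ? ?] /=; lia.
have kn : (k <= n)%N.
  rewrite -(ler_nat F); have := k_small; move: delta_le.
  have : 1 <= k%:R :> F by rewrite ler1n.
  have := n_pos; nra.
pose x : vecF2 n := [ffun i : 'I_n => (i < k)%N].
have xk : Hk k x.
  rewrite /Hk hweight_sum; apply/eqP.
  transitivity (\sum_(i < n | (i < k)%N) 1)%N.
    by rewrite [RHS]big_mkcond; apply: eq_bigr => i _; rewrite ffunE; case: ltnP.
  by rewrite -(big_ord_widen n (fun=> 1%N)) // sum1_card card_ord.
have := D_yes xk; rewrite cst.
have /D_no : ~~ Hk k (vec0 n) by rewrite /Hk hweight_vec0 eq_sym -lt0n.
by move: delta_le; lra.
Qed.

(** If [ln (k / delta)] is below 20000, then [k] is at most [expR 20000]; the constant makes the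
    left side at most [ln 2], and [size_ge2] suffices. Otherwise the constant is below 1 / 80. *)
Lemma ln_size_lb :
  ln 2 * expR (- (200 * 100)) / (200 * 100) * k%:R * ln (k%:R / delta) <= ln s%:R.
Proof.
have kp : 1 <= k%:R :> F by rewrite ler1n.
have kp0 : 0 < k%:R :> F by lra.
have kd_gt0 : 0 < k%:R / delta by rewrite divr_gt0.
have kd_ge1 : 1 <= k%:R / delta.
  by rewrite ler_pdivlMr // mul1r; move: delta_le; lra.
have X0 := ln_ge0 kd_ge1.
have l2 : 0 < ln 2 :> F by apply: ln_gt0; lra.
have l2' : ln 2 < 2 :> F by exact: ln_sublinear.
have e0 : 0 < expR (- (200 * 100)) :> F := expR_gt0 _.
have e1 : expR (- (200 * 100)) <= 1 :> F by rewrite expR_le1; lra.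
have [X_ge|X_lt] := leP (200 * 100) (ln (k%:R / delta)).
  apply: le_trans (ln_size_large X_ge).
  rewrite -mulrA -[leRHS]mulrC ler_pM2r; last first.
    by rewrite mulr_gt0 //; lra.
  nra.
apply: (@le_trans _ _ (ln 2)); last first.
  by rewrite ler_ln ?posrE ?ltr0n ?(ler_nat _ 2) ?size_ge2 // ltnW // size_ge2.
have kE : k%:R * expR (- (200 * 100)) <= 1 :> F.
  rewrite expRN -[leRHS](divff (lt0r_neq0 (expR_gt0 (200 * 100)))).
  rewrite ler_pM2r ?invr_gt0 ?expR_gt0 //.
  apply: (@le_trans _ _ (k%:R / delta)).
    by rewrite ler_pdivlMr // ler_piMr // ?ltW //; move: delta_le; lra.
  by rewrite -[leLHS]lnK ?posrE // ler_expR ltW.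
have : k%:R * expR (- (200 * 100)) * ln (k%:R / delta) <= 1 * (200 * 100) :> F.
  by apply: ler_pM => //; [exact: mulr_ge0 (ltW kp0) (ltW e0) | exact: ltW].
move=> /(ler_wpM2l (ltW l2)); lra.
Qed.

End Distribution.
End RandomizedTree.

(** * Transfer to the distributions and real numbers of the statement *)

Lemma rsumE n (f : Rdefinitions.R * pdt n -> Rdefinitions.R) (D : rpdt n) :
  rsum f D = \sum_(p <- D) f p.
Proof. by elim: D => [|p D IH]; rewrite ?big_nil // big_cons -IH. Qed.

Lemma pdt_size_rpdt n (D : rpdt n) p :
  List.In p D -> (pdt_size p.2 <= rpdt_size D)%N.
Proof.
elim: D => [|q D IH] //= [->|/IH]; first exact: leq_maxl.
by move=> /leq_trans; apply; exact: leq_maxr.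
Qed.

Lemma rpdt_size_gt0 n (D : rpdt n) : is_distribution D -> (0 < rpdt_size D)%N.
Proof.
case: D => [|p D] [_ sum1]; last first.
  have /(leq_trans _) := @pdt_size_rpdt n (p :: D) p (or_introl erefl).
  by apply; case: p.2.
by move: sum1; rewrite rsumE big_nil => /eqP; rewrite eq_sym oner_eq0.
Qed.

Lemma ln_rpdt_size n k (delta : Rdefinitions.R) (D : rpdt n) :
  0 < delta -> delta <= 1 / 3 -> k%:R ^+ 2 < delta * n%:R ->
  is_rpdt_for (@Hk n k) delta D ->
  ln 2 * expR (- (200 * 100)) / (200 * 100) * k%:R * ln (k%:R / delta) <= ln (rpdt_size D)%:R.
Proof.
move=> d0 d3 kn [[D0 D1] ok].
have [->|k0] := posnP k.
  by rewrite mulr0 mul0r ln_ge0 // ler1n rpdt_size_gt0.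
have ok' x : 1 - delta <= prob_correct (@Hk n k) D x by exact/RleP/ok.
have D1' : \sum_(p <- D) p.1 = 1 by rewrite -rsumE.
apply: (@ln_size_lb _ _ _ _ k0 d0 d3 kn D) => //.
- by move=> p /D0 /RltP.
- move=> x xk; apply: le_trans (ok' x) _.
  rewrite /prob_correct rsumE /accept le_eqVlt; apply/orP; left; apply/eqP.
  by apply: eq_bigr => p _; rewrite xk eqb_id; case: ifP; rewrite ?mulr1 ?mulr0.
- move=> x /negPf xk; have := ok' x; rewrite /prob_correct rsumE.
  rewrite (_ : \sum_(p <- D) _ = 1 - accept D x).
    by lra.
  rewrite /accept -[X in X - _]D1' -sumrB; apply: eq_bigr => p _.
  by rewrite xk eqbF_neg; case: (pdt_eval _ _); rewrite ?mulr1 ?mulr0 ?subrr ?subr0.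
- by move=> p; exact: pdt_size_rpdt.
Qed.

(* Imported only here, because it rebinds the delimiters [%R] and [%N]. *)
From Stdlib Require Import Reals.

(* log PS_delta(H^n_k) = Omega(k log(k/delta)) whenever k^2 < delta n:
   there is an absolute constant c > 0 such that every delta-error randomized
   parity decision tree for H^n_k has log2(size) >= c * k * log2(k/delta). *)
Theorem theorem1p9 :
  exists c : R, (0 < c)%R /\
    forall (n k : nat) (delta : R) (D : rpdt n),
      (0 < delta <= 1/3)%R ->
      (INR k ^ 2 < delta * INR n)%R ->
      is_rpdt_for (@Hk n k) delta D ->
      (c * INR k * log2 (INR k / delta) <= log2 (INR (rpdt_size D)))%R.
Proof.
have l2 : 0 < exp.ln 2 :> R by apply: ln_gt0; rewrite ltr1n.
exists (exp.ln 2 * expR (- (200 * 100)) / (200 * 100)); split.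
  by apply/RltP; rewrite divr_gt0 // mulr_gt0 // expR_gt0.
move=> n k delta D [/RltP d0 /RleP d3] /RltP kn ok; apply/RleP.
rewrite /log2 !RlnE !INRE !(RmultE, RdivE) mulrA ler_pM2r ?invr_gt0 //.
apply: ln_rpdt_size ok => //.
by move: kn; rewrite RpowE RmultE !INRE.
Qed.
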